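(* Suppose $S$ is a Seidel matrix with symmetric spectrum and exactly three distinct eigenvalues. Then $S$ can be obtained from a symmetric conference matrix by deleting one row and the corresponding column.
   Context: A Seidel matrix is a real symmetric matrix with diagonal entries $0$ and all off-diagonal entries equal to $1$ or $-1$. The spectrum of a matrix is the multiset of its eigenvalues, counted with multiplicity; a real symmetric matrix with spectrum $\Sigma$ has symmetric spectrum if $\Sigma=-\Sigma$ as multisets. A conference matrix of order $n$ ($n\ge 2$) is an $n\times n$ matrix $C$ with diagonal entries $0$ and off-diagonal entries $\pm1$ satisfying $CC^\top=(n-1)I$. *)

(* Defs.v *)
From mathcomp Require Import all_boot all_order all_algebra.
From mathcomp Require Import polyrcf reals.

Set Implicit Arguments.
Unset Strict Implicit.
Unset Printing Implicit Defensive.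

Import Order.TTheory GRing.Theory Num.Theory.
Local Open Scope ring_scope.

Definition zero_diag_pm1 (R : realType) (n : nat) (A : 'M[R]_n) : Prop :=
  (forall i, A i i = 0) /\ (forall i j, i != j -> A i j = 1 \/ A i j = -1).

Definition seidel (R : realType) (n : nat) (S : 'M[R]_n) : Prop :=
  S^T = S /\ zero_diag_pm1 S.

Definition conference (R : realType) (n : nat) (C : 'M[R]_n) : Prop :=
  [/\ (2 <= n)%N, zero_diag_pm1 C & C *m C^T = (n.-1%:R)%:M].

(* The multiset of real eigenvalues, to be compared with [perm_eq].  For real
   symmetric matrices all eigenvalues are real and the algebraic multiplicity
   used here is also the geometric one, so nothing is lost. *)
Definition spectrum (R : realType) (n : nat) (A : 'M[R]_n) : seq R :=
  flatten [seq nseq (mup x (char_poly A)) x | x <- rootsR (char_poly A)].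

Definition symmetric_spectrum (R : realType) (n : nat) (A : 'M[R]_n) : Prop :=
  perm_eq (spectrum A) [seq - x | x <- spectrum A].

Definition num_distinct_eigenvalues (R : realType) (n : nat) (A : 'M[R]_n) :
  nat := size (undup (spectrum A)).

Lemma count_spectrum (R : realType) (n : nat) (A : 'M[R]_n) (x : R) :
  count_mem x (spectrum A) = mup x (char_poly A).
Proof.
have p0 : char_poly A != 0 by rewrite monic_neq0 ?char_poly_monic.
rewrite count_flatten -map_comp sumnE big_map.
under eq_bigr do rewrite /= count_nseq /=.
have [xr|xr] := boolP (x \in rootsR (char_poly A)).
  rewrite (bigD1_seq x) ?uniq_roots //= eqxx mul1n big1 ?addn0 // => y.
  by move/negPf->.
rewrite mupNroot ?big_seq; last first.
  by have := roots_on_rootsR p0 x; rewrite /= (negPf xr) => ->.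
by rewrite big1 // => y yr; case: eqP => [yx|//]; rewrite -yx yr in xr.
Qed.

Lemma mem_spectrum (R : realType) (n : nat) (A : 'M[R]_n) (x : R) :
  (x \in spectrum A) = eigenvalue A x.
Proof.
have p0 : char_poly A != 0 by rewrite monic_neq0 ?char_poly_monic.
rewrite -has_pred1 has_count count_spectrum eigenvalue_root_char.
by rewrite -XsubC_dvd // dvdp_XsubCl.
Qed.

(* Main.v *)
Require Import Defs.
From mathcomp Require Import all_boot all_order all_algebra.
From mathcomp Require Import reals.
From mathcomp Require Import spectral complex ring lra.

Import Order.TTheory GRing.Theory Num.Theory.
Local Open Scope ring_scope.

(** The eigenvalues of S are 0, t and - t for some t <> 0: a three-element set
    closed under negation contains 0.  Since S is real symmetric, hence
    diagonalizable, S^3 = t^2 S ([symmetric_horner_mx_eq0]), so that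
    E = 1 - t^-2 S^2 is the orthogonal projector onto the kernel of S.

    The kernel is a line, for a parity reason.  Modulo 2 every Seidel matrix is
    J - I, with J the all-ones matrix, and this is invertible when the order is
    even ([seidel_even_unitmx]).  So the singular matrix S has odd order n, and
    as its principal minors of order n - 1 are nonzero, a kernel vector is
    determined by its first coordinate ([seidel_odd_kernel_coord]).

    Thus E is a projector of rank one, and its diagonal is constant because
    that of S^2 is constantly n - 1.  Having trace 1, it has diagonal entries
    1/n, and comparing with 1 - (n - 1) / t^2 gives t^2 = n.  Rank one
    symmetric matrices satisfy E_ij^2 = E_ii E_jj, so the entries of n E are
    all 1 or - 1 and n E = w^T w for w its first row.  Then w S = 0 and
    S^2 = n I - w^T w, which say exactly that S bordered by w is a conference
    matrix of order n + 1 ([seidel_border]).  [seidel_cube_border] carries out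
    this last computation. *)

(** A real symmetric matrix becomes diagonal over the complex numbers, with
    real diagonal entries, each of them an eigenvalue of the real matrix. *)
Lemma symmetric_horner_mx_eq0 {R : rcfType} {n} {A : 'M[R]_n.+1} (p : {poly R}) :
  A^T = A -> (forall x, eigenvalue A x -> root p x) -> horner_mx A p = 0.
Proof.
move=> symA rootp; pose f := real_complex R; pose B := map_mx f A.
have hermB : B \is hermsymmx.
  apply: realsym_hermsym.
    by apply/is_hermitianmxP; rewrite expr0 scale1r map_mx_id // map_trmx symA.
  by apply/mxOverP => i j; rewrite mxE; apply/complex_realP; exists (A i j).
have Punit := spectral_unit B; have dreal := hermitian_spectral_diag_real hermB.
have /orthomx_spectralP := hermitian_normalmx hermB.
move: (spectralmx B) (spectral_diag B) Punit dreal => P d Punit dreal BE.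
apply: (map_mx_inj (f := f)); rewrite map_horner_mx map_mx0 -/B {1}BE.
rewrite horner_mx_uconjC // horner_mx_diag.
suff -> : map_mx (horner (map_poly f p)) d = 0.
  by rewrite raddf0 mulmx0 mul0mx.
apply/rowP => i; rewrite !mxE.
have /complex_realP[r dr] : d 0 i \is Num.real by apply: (mxOverP dreal).
suff /rootp/rootP pr : eigenvalue A r by rewrite dr horner_map pr rmorph0.
rewrite -(eigenvalue_map f) -/B; apply/eigenvalueP; exists (row i P).
  rewrite -row_mul {1}BE !mulmxA mulmxV // mul1mx.
  by rewrite row_mul row_diag_mx dr -scalemxAl -rowE.
apply/eqP => /(congr1 (mulmx^~ (invmx P))).
rewrite rowE mulmxK // mul0mx => /rowP/(_ i) /eqP.
by rewrite !mxE !eqxx oner_eq0.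
Qed.

(** If x is a nonzero member then so is - x, and the third member, being
    neither x nor - x, must be its own opposite. *)
Lemma symmetric_seq3 {R : realDomainType} {s : seq R} :
  uniq s -> size s = 3%N -> (forall x, x \in s -> - x \in s) ->
  exists2 t, t != 0 & s =i [:: 0; t; - t].
Proof.
move=> us ss opps.
have [t ts t0] : exists2 t, t \in s & t != 0.
  apply/hasP; apply/negPn; rewrite has_predC negbK.
  by apply: contraL us => /all_pred1P ->; rewrite ss /= inE eqxx.
exists t => //; have tNt : - t != t by rewrite eqNr.
have p1 := perm_to_rem ts.
have Nt1 : - t \in rem t s by rewrite mem_rem_uniq // !inE tNt opps.
have p2 := perm_to_rem Nt1.
move: (rem (- t) (rem t s)) p2 => s' p2.
have p : perm_eq s [:: t, - t & s'].
  by rewrite (permPl p1) perm_cons.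
move: (perm_size p); rewrite ss; case: s' {p2} p => [|c []] // p _.
have := perm_uniq p; rewrite us /= !inE !negb_or andbT.
move=> /esym/andP[/andP[_ tc] Ntc].
have : - c \in s by rewrite opps // (perm_mem p) !inE eqxx !orbT.
rewrite (perm_mem p) !inE eqr_oppLR eq_sym (negPf Ntc) eqr_opp eq_sym (negPf tc).
rewrite /= eqNr => /eqP c0 x.
by rewrite (perm_mem p) c0 !inE orbA orbC.
Qed.

(** The determinant is an integer whose residue modulo 2 is det (J + I).  The
    latter is nonzero since (J + I)^2 = n J + 2 J + I = I in characteristic 2
    for n even. *)
Lemma seidel_even_unitmx {R : realType} {n} {S : 'M[R]_n} :
  seidel S -> ~~ odd n -> S \in unitmx.
Proof.
case=> _ [S0 S1] n_even.
pose M : 'M[int]_n :=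
  \matrix_(i, j) (if i == j then 0 else if S i j == 1 then 1 else -1).
have SE : S = map_mx intr M.
  apply/matrixP => i j; rewrite !mxE; have [<-|ij] := eqVneq i j; first by rewrite S0.
  by case: eqP => [->//|]; case: (S1 i j ij).
rewrite SE unitmxE det_map_mx unitfE intr_eq0.
suff : (\det M)%:~R != 0 :> 'F_2 by apply: contraNneq => ->.
have N1 : -1 = 1 :> 'F_2 by apply/eqP.
pose J : 'M['F_2]_n := const_mx 1.
have ME : map_mx intr M = J + 1%:M.
  apply/matrixP => i j; rewrite !mxE; have [_|ij] := eqVneq i j.
    by apply/eqP.
  by rewrite addr0; case: ifP.
have JJ : J *m J = 0.
  apply/matrixP => i j; rewrite !mxE (eq_bigr (fun=> 1)).
    rewrite sumr_const card_ord; apply/eqP.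
    by rewrite -(dvdn_pcharf (pchar_Fp _)) // dvdn2.
  by move=> k _; rewrite !mxE mulr1.
rewrite -det_map_mx -unitfE -unitmxE ME.
have : (J + 1%:M) *m (J + 1%:M) = 1%:M.
  rewrite mulmxDl !mulmxDr JJ !mulmx1 mul1mx add0r addrA -[J + J]mulr2n.
  have -> : J *+ 2 = 0 by apply/matrixP => i j; rewrite !mxE; apply/eqP.
  by rewrite add0r.
by case/mulmx1_unit.
Qed.

(** A kernel vector vanishing at 0 restricts to a kernel vector of the
    principal submatrix without row 0, which is Seidel of even order. *)
Lemma seidel_odd_kernel_coord {R : realType} {n} {S : 'M[R]_n.+1} {v : 'rV_n.+1} :
  seidel S -> ~~ odd n -> v *m S = 0 -> v 0 0 = 0 -> v = 0.
Proof.
case=> [symS [S0 S1]] n_even vS v0.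
have minorS : seidel (row' 0 (col' 0 S)).
  split; first by apply/matrixP => i j; rewrite !mxE -{1}symS mxE.
  split=> [i|i j ij]; rewrite !mxE ?S0 // ; apply: S1.
  by apply: contra_neq ij => /lift_inj.
suff v'0 : col' 0 v = 0.
  apply/rowP => i; case: (unliftP 0 i) => [i' ->|->]; last by rewrite v0 mxE.
  by have /rowP/(_ i') := v'0; rewrite !mxE.
rewrite -[LHS](mulmxK (seidel_even_unitmx minorS n_even)).
suff -> : col' 0 v *m row' 0 (col' 0 S) = 0 by rewrite mul0mx.
apply/rowP => j; have /rowP/(_ (lift 0 j)) := vS.
rewrite !mxE big_ord_recl v0 mul0r add0r => {2}<-.
by apply: eq_bigr => k _; rewrite !mxE.
Qed.

(** The kernel has dimension at most one, in the form of vanishing minors: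
    u_0 v - v_0 u is a kernel vector with vanishing coordinate 0. *)
Lemma seidel_odd_kernel_minor {R : realType} {n} {S : 'M[R]_n.+1} {u v : 'rV_n.+1} j :
  seidel S -> ~~ odd n -> u *m S = 0 -> v *m S = 0 ->
  u 0 0 * v 0 j = v 0 0 * u 0 j.
Proof.
move=> seidelS n_even uS vS; apply/eqP; rewrite -subr_eq0; apply/eqP.
have /rowP/(_ j) : u 0 0 *: v - v 0 0 *: u = 0.
  apply: (seidel_odd_kernel_coord seidelS n_even).
    by rewrite mulmxBl -!scalemxAl uS vS !scaler0 subr0.
  by rewrite !mxE mulrC subrr.
by rewrite !mxE.
Qed.

(** The square of the block matrix ((0, w), (w^T, S)) has blocks w w^T = m,
    w S = 0, its transpose, and w^T w + S^2 = m I. *)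
Lemma seidel_border {R : realType} {m} {S : 'M[R]_m} {w : 'rV_m} :
  (0 < m)%N -> seidel S -> (forall i, w 0 i = 1 \/ w 0 i = -1) ->
  w *m S = 0 -> S *m S = m%:R%:M - w^T *m w ->
  exists (C : 'M[R]_m.+1) (i : 'I_m.+1),
    [/\ conference C, C^T = C & S = row' i (col' i C)].
Proof.
move=> m_gt0 [symS [S0 S1]] w1 wS SS.
have ww : w *m w^T = m%:R%:M.
  apply/matrixP => i j; rewrite !ord1 !mxE (eq_bigr (fun=> 1)).
    by rewrite sumr_const card_ord.
  by move=> k _; rewrite mxE; case: (w1 k) => ->; rewrite ?mulrNN mulr1.
pose C : 'M[R]_(1 + m) := block_mx 0 w w^T S.
have symC : C^T = C by rewrite tr_block_mx symS trmxK trmx0.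
have pm1C : zero_diag_pm1 C.
  split=> [i|i j].
    by case: (split_ordP i) => k ->; rewrite ?block_mxEul ?block_mxEdr ?mxE.
  case: (split_ordP i) => k ->; case: (split_ordP j) => l -> kl.
  - by rewrite !ord1 eqxx in kl.
  - by rewrite block_mxEur ord1.
  - by rewrite block_mxEdl mxE ord1.
  - by rewrite block_mxEdr; apply: S1; apply: contra_neq kl => ->.
have CC : C *m C^T = m%:R%:M.
  have Sw : S *m w^T = 0 by rewrite -symS -trmx_mul wS trmx0.
  rewrite symC mulmx_block !mul0mx !mulmx0 wS Sw ww !add0r SS addrC subrK.
  by rewrite -scalar_mx_block.
have SC : S = row' ord0 (col' ord0 (C : 'M_m.+1)).
  apply/matrixP => i j; rewrite mxE [RHS]mxE.
  have -> : S i j = C (rshift 1 i) (rshift 1 j) by rewrite block_mxEdr.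
  by congr (C _ _); apply: val_inj.
by exists C, ord0.
Qed.

Lemma seidel_sqr_diag {R : realType} {n} {S : 'M[R]_n} i :
  seidel S -> (S *m S) i i = n.-1%:R.
Proof.
case=> symS [S0 S1]; rewrite mxE (bigD1 i) //= S0 mul0r add0r (eq_bigr (fun=> 1)).
  by rewrite sumr_const cardC1 card_ord.
move=> k ki; have -> : S k i = S i k by rewrite -{1}symS mxE.
by case: (S1 i k); rewrite 1?eq_sym // => ->; rewrite ?mulrNN mulr1.
Qed.

(** The hypotheses say that S is diagonalizable with 0 as an eigenvalue and
    all other eigenvalues square roots of a; the kernel being a line then
    forces a to be the order of S. *)
Lemma seidel_cube_border {R : realType} {m} {S : 'M[R]_m} {a : R} :
  seidel S -> S \notin unitmx -> S != 0 -> a != 0 -> S *m S *m S = a *: S ->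
  exists (C : 'M[R]_m.+1) (i : 'I_m.+1),
    [/\ conference C, C^T = C & S = row' i (col' i C)].
Proof.
move=> hS; have [symS [S0 S1]] := hS => Ssing S_neq0 a0 S3.
have m_odd : odd m by apply: contraNT Ssing; apply: seidel_even_unitmx.
case: m => // n in S hS symS S0 S1 Ssing S_neq0 S3 m_odd *.
have n0 : n%:R != 0 :> R.
  apply: contraNneq S_neq0 => /eqP; rewrite pnatr_eq0 => /eqP n0.
  by subst n; apply/eqP/matrixP => i j; rewrite !ord1 S0 mxE.
(* The orthogonal projector onto the kernel of S. *)
pose E := 1%:M - a^-1 *: (S *m S).
have ES : E *m S = 0.
  by rewrite mulmxBl mul1mx -scalemxAl S3 scalerA mulVf // scale1r subrr.
have EE : E *m E = E.
  by rewrite {2}/E mulmxBr mulmx1 -scalemxAr mulmxA ES mul0mx scaler0 subr0.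
have symE : E^T = E by rewrite linearB /= trmx1 linearZ /= trmx_mul symS.
pose e : R := 1 - a^-1 * n%:R.
have Ee i : E i i = e by rewrite /e -(seidel_sqr_diag i hS) !mxE eqxx.
have SSE : S *m S = a *: (1%:M - E).
  by rewrite subKr scalerA mulfV // scale1r.
clearbody E.
have rank1 i j : E 0 0 * E i j = E 0 i * E 0 j.
  have rowE k : row k E *m S = 0 by rewrite -row_mul ES row0.
  have := seidel_odd_kernel_minor j hS m_odd (rowE 0) (rowE i).
  by rewrite !mxE => ->; rewrite -{1}symE mxE.
have e0 : e != 0.
  (* If e = 0 then E_00 = 0, which kills row 0 of E, hence column 0 by symmetry,
     hence every row. *)
  apply: contraNneq Ssing => e0.
  suff E0 : E = 0.
    have : S *m (a^-1 *: S) = 1%:M.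
      by rewrite -scalemxAr SSE E0 subr0 scalerA mulVf // scale1r.
    by case/mulmx1_unit.
  have row0E i : E i 0 = 0 -> row i E = 0.
    move=> Ei0; apply: (seidel_odd_kernel_coord hS m_odd).
      by rewrite -row_mul ES row0.
    by rewrite mxE.
  apply/row_matrixP => i; rewrite row0; apply: (row0E).
  by have /rowP/(_ i) := row0E 0 (etrans (Ee 0) e0); rewrite !mxE -{1}symE mxE.
(* The (0, 0) entry of E^2 = E reads n.+1 * e^2 = e. *)
have ne : n.+1%:R * e = 1.
  apply: (mulIf e0); rewrite mul1r -mulrA.
  have /matrixP/(_ 0 0) := EE; rewrite mxE Ee => sumE; rewrite -[RHS]sumE.
  rewrite (eq_bigr (fun=> e * e)) ?sumr_const ?card_ord ?mulr_natl // => k _.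
  by rewrite -[in E k 0]symE mxE -rank1 !Ee.
have a_order : a = n.+1%:R.
  apply: (mulIf n0); move: ne; rewrite /e -[n.+1]addn1 natrD => ne.
  have : a = a * ((n%:R + 1) * (1 - a^-1 * n%:R)) by rewrite ne mulr1.
  have -> : a * ((n%:R + 1) * (1 - a^-1 * n%:R)) =
      (n%:R + 1) * (a - n%:R) by field.
  lra.
pose w := n.+1%:R *: row 0 E.
apply: (@seidel_border R n.+1 S w) => //.
- move=> i; apply/pred2P; rewrite -sqrf_eq1 !mxE exprMn.
  by rewrite [E 0 i ^+ 2]expr2 -rank1 !Ee -expr2 -exprMn ne expr1n.
- by rewrite -scalemxAl -row_mul ES row0 scaler0.
have -> : w^T *m w = n.+1%:R *: E.
  apply/matrixP => i j; rewrite mxE big_ord1 !mxE mulrACA -rank1 Ee.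
  by rewrite mulrACA ne mul1r.
by rewrite SSE a_order scalerBr scalemx1.
Qed.

Theorem theorem2 (R : realType) (m : nat) (S : 'M[R]_m)
    (hS : seidel S) (hsym : symmetric_spectrum S)
    (h3 : num_distinct_eigenvalues S = 3%N) :
  exists (C : 'M[R]_m.+1) (i : 'I_m.+1),
    [/\ conference C, C^T = C & S = row' i (col' i C)].
Proof.
have [t t0 specS] :
    exists2 t, t != 0 & forall x, eigenvalue S x = (x \in [:: 0; t; - t]).
  have [||x|t t0 tE] := symmetric_seq3 (s := undup (spectrum S)).
  - exact: undup_uniq.
  - exact: h3.
  - rewrite !mem_undup (perm_mem hsym (- x)) => xS.
    exact: map_f.
  - by exists t => // x; rewrite -mem_spectrum -mem_undup tE.
have Ssing : S \notin unitmx.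
  have /eigenvalueP[v] : eigenvalue S 0 by rewrite specS inE eqxx.
  rewrite scale0r => vS; apply: contraNN => Sunit.
  by rewrite -[v](mulmxK Sunit) vS mul0mx.
have S_neq0 : S != 0.
  have /eigenvalueP[u uS] : eigenvalue S t by rewrite specS !inE eqxx orbT.
  apply: contraNneq => S0; move/eqP: uS.
  by rewrite S0 mulmx0 eq_sym scaler_eq0 (negPf t0).
apply: (seidel_cube_border hS Ssing S_neq0 (expf_neq0 2 t0)).
have [symS _] := hS.
case: m => [|n] in S symS specS {hS hsym h3 Ssing S_neq0} *.
  by apply/matrixP => - [].
have := symmetric_horner_mx_eq0 ('X^3 - (t ^+ 2)%:P * 'X) symS.
rewrite rmorphB !rmorphM /= horner_mx_X horner_mx_C => S3.
apply/eqP; rewrite -subr_eq0; apply/eqP; rewrite -S3.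
  by rewrite -mulmxA -mul_scalar_mx expr2 scalar_mxM.
move=> x; rewrite specS !inE => xE; apply/rootP; rewrite !hornerE.
by case/or3P: xE => /eqP ->; ring.
Qed.
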